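(* Let $(G_1,h_1,k_1)$ and $(G_2,h_2,k_2)$ be two commutative Krasner $(m,n)$-hyperrings with scalar identities, let $\delta$ and $\delta'$ be hyperideal expansions of $G_1$ and $G_2$ respectively, let $t$ be a positive integer, and let $f:G_1\to G_2$ be a $\delta\delta'$-homomorphism. Then the following hold. (i) If $Q_2$ is a $(t,n)$-absorbing $\delta'$-semiprimary hyperideal of $G_2$, then $f^{-1}(Q_2)$ is a $(t,n)$-absorbing $\delta$-semiprimary hyperideal of $G_1$. (ii) If $Q_2$ is a weakly $(t,n)$-absorbing $\delta'$-semiprimary hyperideal of $G_2$ and $\operatorname{Ker} f$ is a weakly $(t,n)$-absorbing $\delta$-semiprimary hyperideal of $G_1$, then $f^{-1}(Q_2)$ is a weakly $(t,n)$-absorbing $\delta$-semiprimary hyperideal of $G_1$. (iii) Let $f$ be an epimorphism and let $Q_1$ be a proper hyperideal of $G_1$ containing $\operatorname{Ker} f$. If $Q_1$ is a $(t,n)$-absorbing $\delta$-semiprimary (respectively, weakly $(t,n)$-absorbing $\delta$-semiprimary) hyperideal of $G_1$, then $f(Q_1)$ is a $(t,n)$-absorbing $\delta'$-semiprimary (respectively, weakly $(t,n)$-absorbing $\delta'$-semiprimary) hyperideal of $G_2$.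
   Context: Notation: $a_i^j$ is the sequence $a_i,a_{i+1},\dots,a_j$ (empty if $j<i$), $a^{(r)}$ is $a$ repeated $r$ times; $m,n\ge 2$ are integers. A Krasner $(m,n)$-hyperring $(G,h,k)$ consists of a set $G$, an $m$-ary hyperoperation $h$ (with values nonempty subsets of $G$, extended to subsets by unions) and an $n$-ary operation $k:G^n\to G$ such that: (1) $(G,h)$ is a canonical $m$-ary hypergroup, i.e. $h$ is associative and invariant under permutation of its arguments, there is a unique element $0$ with $h(x,0^{(m-1)})=\{x\}$ for all $x$, each $x$ has a unique $-x$ with $0\in h(x,-x,0^{(m-2)})$, and $x\in h(x_1^m)$ implies $x_i\in h(x,-x_1,\dots,-x_{i-1},-x_{i+1},\dots,-x_m)$ for each $i$; (2) $k$ is associative ($(G,k)$ is an $n$-ary semigroup); (3) $k(g_1^{i-1},h(x_1^m),g_{i+1}^n)=h(k(g_1^{i-1},x_1,g_{i+1}^n),\dots,k(g_1^{i-1},x_m,g_{i+1}^n))$ for each $i$; (4) $k$ equals $0$ whenever one of its arguments is $0$. It is commutative if $k$ is invariant under permutation of its arguments; $1$ is a scalar identity if $k(x,1^{(n-1)})=x$ for all $x$. By iterating, $k$ is defined on any $l(n-1)+1$ elements, $l\ge 0$ (for $l=0$ the product of one element is that element); note $tn-t+1=t(n-1)+1$ and $(t-1)n-t+2=(t-1)(n-1)+1$. A hyperideal is a nonempty $I\subseteq G$ such that $(I,h)$ is an $m$-ary subhypergroup of $(G,h)$ (so $I$ is closed under $h$ and negatives) and $k(g_1^{i-1},I,g_{i+1}^n)\subseteq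 I$ for all $g_j\in G$ and all $i$. A hyperideal expansion of $G$ is a function $\delta$ from hyperideals to hyperideals of $G$ with $I\subseteq\delta(I)$, and $I\subseteq J$ implying $\delta(I)\subseteq\delta(J)$. A proper hyperideal $Q$ of $G$ is $(t,n)$-absorbing $\delta$-semiprimary if whenever $k(a_1^{tn-t+1})\in Q$ for $a_1,\dots,a_{tn-t+1}\in G$, there exist $(t-1)n-t+2$ of the $a_i$'s (distinct indices) whose $k$-product is in $\delta(Q)$. It is weakly $(t,n)$-absorbing $\delta$-semiprimary if the same conclusion holds whenever $0\ne k(a_1^{tn-t+1})\in Q$. A map $f:G_1\to G_2$ is a homomorphism if $f(h_1(a_1^m))=h_2(f(a_1),\dots,f(a_m))$ and $f(k_1(b_1^n))=k_2(f(b_1),\dots,f(b_n))$ for all $a_j,b_j\in G_1$; an epimorphism is a surjective homomorphism; $\operatorname{Ker} f=f^{-1}(0)$. A homomorphism $f$ is a $\delta\delta'$-homomorphism if $\delta(f^{-1}(Q_2))=f^{-1}(\delta'(Q_2))$ for every hyperideal $Q_2$ of $G_2$.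
   Formalization: In (i) and (ii) the preimage of Q_2 is additionally assumed to be different from G_1, since f need not preserve the scalar identity and the preimage can be all of G_1 (e.g. f = 0 between fields), which is not proper. *)

(* Defs.v *)
From mathcomp Require Import all_boot perm.
From mathcomp Require Import boolp classical_sets.

Set Implicit Arguments.
Unset Strict Implicit.
Unset Printing Implicit Defensive.

Local Open Scope classical_set_scope.

(* Argument lists are functions on ordinals, so positions start at 0. *)

(* [pad c [:: x; ..; y]] is the argument list (x, .., y, c, .., c). *)
Definition pad (T : Type) (c : T) (s : seq T) (n : nat) : 'I_n -> T :=
  fun j => nth c s j.
Arguments pad {T} c s {n} _.

(* (a_0, .., a_(i-1), y, a_(i+n), .., a_(2n-2)): the outer argument list after
   the block a_i, .., a_(i+n-1) has been replaced by the single entry y. *)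
Definition splice (T : Type) (n : nat) (a : nat -> T) (i : nat) (y : T) :
    'I_n -> T :=
  fun j => if (j < i)%N then a j else if j == i :> nat then y else a (j + n.-1).

Definition block (T : Type) (n : nat) (a : nat -> T) (i : nat) : 'I_n -> T :=
  fun l => a (i + l).

Definition put (T : Type) (n : nat) (g : 'I_n -> T) (i : 'I_n) (y : T) :
    'I_n -> T :=
  fun j => if j == i then y else g j.

Definition hext (T : Type) (m : nat) (h : ('I_m -> T) -> set T)
    (A : 'I_m -> set T) : set T :=
  [set y | exists2 x : 'I_m -> T, (forall j, A j (x j)) & h x y].

Record canonical_hypergroup (m : nat) (T : Type)
    (h : ('I_m -> T) -> set T) (zero : T) (opp : T -> T) : Prop := {
  hyp_nonempty : forall a, h a !=set0;
  (* only a_0, .., a_(2m-2) matter here *)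
  hyp_assoc : forall (a : nat -> T) (i j : 'I_m),
    hext h (splice (fun l => [set a l]) i (h (block a i))) =
    hext h (splice (fun l => [set a l]) j (h (block a j)));
  hyp_perm : forall (s : {perm 'I_m}) (a : 'I_m -> T), h (a \o s) = h a;
  hyp_zero : forall x, h (pad zero [:: x]) = [set x];
  hyp_zero_uniq : forall e,
    (forall x, h (pad e [:: x]) = [set x]) -> e = zero;
  hyp_opp : forall x, h (pad zero [:: x; opp x]) zero;
  hyp_opp_uniq : forall x y, h (pad zero [:: x; y]) zero -> y = opp x;
  hyp_rev : forall (a : 'I_m -> T) (x : T) (i : 'I_m), h a x ->
    h (pad zero (x :: [seq opp (a j) | j <- enum 'I_m & j != i])) (a i)
}.

Record krasner_hyperring (m n : nat) : Type := KrasnerHyperring {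
  carrier :> Type;
  hadd : ('I_m -> carrier) -> set carrier;
  kmul : ('I_n -> carrier) -> carrier;
  kzero : carrier;
  kopp : carrier -> carrier;
  hadd_canonical : canonical_hypergroup hadd kzero kopp;
  (* only a_0, .., a_(2n-2) matter here *)
  kmul_assoc : forall (a : nat -> carrier) (i j : 'I_n),
    kmul (splice a i (kmul (block a i))) = kmul (splice a j (kmul (block a j)));
  kmul_distr : forall (g : 'I_n -> carrier) (i : 'I_n) (x : 'I_m -> carrier),
    [set kmul (put g i y) | y in hadd x] =
    hadd (fun j => kmul (put g i (x j)));
  kmul_zero : forall (a : 'I_n -> carrier) (i : 'I_n),
    a i = kzero -> kmul a = kzero
}.
Arguments hadd {m n _} a _.
Arguments kmul {m n _} a.
Arguments kzero {m n _}.
Arguments kopp {m n _} x.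

Section Hyperring.
Variables m n : nat.
Implicit Type G : krasner_hyperring m n.

Definition kcommutative G : Prop :=
  forall (s : {perm 'I_n}) (a : 'I_n -> G), kmul (a \o s) = kmul a.

Definition scalar_identity G (e : G) : Prop :=
  forall x : G, kmul (pad e [:: x]) = x.

(* k(k(..k(a_0, .., a_(n-1)), a_n, .., a_(2(n-1))), .., a_(l(n-1))) *)
Fixpoint kiter G (l : nat) (a : nat -> G) : G :=
  if l is l'.+1 then
    kmul (fun j : 'I_n => if j == 0 :> nat then kiter l' a
                          else a (l' * n.-1 + j))
  else a 0.

Definition kprod G (l : nat) (a : 'I_(l * n.-1).+1 -> G) : G :=
  kiter l (fun i => a (inord i)).

(* [hyperideal_add] and [hyperideal_opp] say that (I, h) is an m-ary
   subhypergroup. *)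
Record is_hyperideal G (I : set G) : Prop := {
  hyperideal_nonempty : I !=set0;
  hyperideal_add : forall a : 'I_m -> G,
    (forall j, I (a j)) -> hadd a `<=` I;
  hyperideal_opp : forall x, I x -> I (kopp x);
  hyperideal_mul : forall (g : 'I_n -> G) (i : 'I_n), I (g i) -> I (kmul g)
}.

Record hyperideal G : Type := Hyperideal {
  hyperideal_set :> set G;
  hyperidealP : is_hyperideal hyperideal_set
}.

Record hyperideal_expansion G (delta : hyperideal G -> hyperideal G) : Prop := {
  expansion_sub : forall I : hyperideal G, I `<=` delta I;
  expansion_mono : forall I J : hyperideal G, I `<=` J -> delta I `<=` delta J
}.

(* These are predicates on subsets, so that they apply to images and preimages;
   being a proper hyperideal is part of the definition. *)
Definition absorbing_semiprimary G (t : nat)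
    (delta : hyperideal G -> hyperideal G) (Q : set G) : Prop :=
  exists I : hyperideal G,
    [/\ I = Q :> set G, Q <> setT &
      forall a : 'I_(t * n.-1).+1 -> G, Q (kprod a) ->
        exists2 s : 'I_(t.-1 * n.-1).+1 -> 'I_(t * n.-1).+1,
          injective s & (delta I : set G) (kprod (a \o s))].

Definition weakly_absorbing_semiprimary G (t : nat)
    (delta : hyperideal G -> hyperideal G) (Q : set G) : Prop :=
  exists I : hyperideal G,
    [/\ I = Q :> set G, Q <> setT &
      forall a : 'I_(t * n.-1).+1 -> G, kprod a <> kzero -> Q (kprod a) ->
        exists2 s : 'I_(t.-1 * n.-1).+1 -> 'I_(t * n.-1).+1,
          injective s & (delta I : set G) (kprod (a \o s))].

Record homomorphism (G1 G2 : krasner_hyperring m n) (f : G1 -> G2) : Prop := {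
  hom_hadd : forall a : 'I_m -> G1, f @` hadd a = hadd (f \o a);
  hom_kmul : forall b : 'I_n -> G1, f (kmul b) = kmul (f \o b)
}.

Definition epimorphism (G1 G2 : krasner_hyperring m n) (f : G1 -> G2) : Prop :=
  homomorphism f /\ forall y, exists x, f x = y.

Definition Ker (G1 G2 : krasner_hyperring m n) (f : G1 -> G2) : set G1 :=
  f @^-1` [set kzero].

(* delta only acts on hyperideals, so the equation defining a
   delta-delta'-homomorphism presupposes that the preimages of hyperideals are
   hyperideals. This is not automatic: a homomorphism as above need not map
   zero to zero, e.g. the constant map 1 into the hyperfield of signs. *)
Record expansion_homomorphism (G1 G2 : krasner_hyperring m n)
    (delta : hyperideal G1 -> hyperideal G1)
    (delta' : hyperideal G2 -> hyperideal G2) (f : G1 -> G2) : Prop := {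
  expansion_hom :> homomorphism f;
  expansion_hom_preimage : forall Q2 : hyperideal G2,
    exists2 P : hyperideal G1, P = f @^-1` Q2 :> set G1 &
      delta P = f @^-1` (delta' Q2) :> set G1
}.

End Hyperring.

(* Main.v *)
Require Import Defs.
From mathcomp Require Import all_boot perm.
From mathcomp Require Import boolp classical_sets.

(** The whole argument rests on [f 0 = 0].  It holds because [{0}] is a hyperideal
of [G2], so its preimage is by hypothesis a hyperideal of [G1], and every
hyperideal contains [0] ([hyperideal0], [hom_kzero]).  Since [f] commutes with
iterated products ([hom_kprod]), a subproduct of [f a_1, f a_2, ...] lies in
[delta' I] iff the same subproduct of the [a_i] lies in the preimage of
[delta' I], which is [delta] of the preimage of [I].  This gives (i), and (ii)
when the image of the product is nonzero; when that image is zero, the product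
is a nonzero element of [Ker f], and [delta (Ker f)] is contained in [delta] of
the preimage of [Q2] by monotonicity.

For (iii), a hyperideal [Q1] containing [Ker f] is saturated, that is
[f^-1 (f Q1) = Q1] ([preimage_image_hyperideal]): if [f x = f q] with [q] in
[Q1], then [0] is in [h (f x, - f q, 0, ..)], so some [z] in
[h (x, - q, 0, ..)] lies in [Ker f], and reversibility puts [x] in
[h (z, q, 0, ..)], a subset of [Q1].  Hence, for [f] onto, [f Q1] is a proper
hyperideal, and tuples of [G2] can be lifted to [G1]. *)

Local Open Scope classical_set_scope.

Set Implicit Arguments.
Unset Strict Implicit.
Unset Printing Implicit Defensive.

(** * Zero, opposites and hyperideals *)

Section Hyperideals.
Variables (m n : nat) (hm : (1 < m)%N) (hn : (1 < n)%N).
Variable G : krasner_hyperring m n.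

Lemma pad_nil (c : G) : pad c [::] = (fun=> c) :> ('I_m -> G).
Proof. by apply: funext => j; rewrite /pad nth_nil. Qed.

Lemma pad_default (c : G) (s : seq G) :
  pad c (rcons s c) = pad c s :> ('I_m -> G).
Proof.
apply: funext => j; rewrite /pad nth_rcons.
case: ltngtP => // h; first by rewrite nth_default // ltnW.
by rewrite h nth_default.
Qed.

Lemma hadd0 : hadd (fun=> kzero) = [set (kzero : G)].
Proof. by rewrite -(hyp_zero (hadd_canonical G)) (pad_default _ [::]) pad_nil. Qed.

Lemma kopp0 : kopp (kzero : G) = kzero.
Proof.
apply/esym/(hyp_opp_uniq (hadd_canonical G)).
by rewrite (pad_default _ [:: kzero]) (hyp_zero (hadd_canonical G)).
Qed.

Lemma hyperideal0 (I : set G) : is_hyperideal I -> I kzero.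
Proof.
case=> -[x Ix] _ _ Imul.
(* 0 is the product of an element of I by zeros. *)
rewrite -(@kmul_zero _ _ G (pad kzero [:: x]) (Ordinal hn)) //.
exact: (Imul _ (Ordinal (ltnW hn))).
Qed.

Lemma pad_in (I : set G) (c : G) (s : seq G) (j : 'I_m) :
  I c -> (forall i, (i < size s)%N -> I (nth c s i)) -> I (pad c s j).
Proof.
move=> Ic Is; rewrite /pad; case: (ltnP j (size s)) => [/Is //|h].
by rewrite nth_default.
Qed.

Lemma is_hyperideal_zero : is_hyperideal [set (kzero : G)].
Proof.
split.
- by exists kzero.
- move=> a a0; have -> : a = (fun=> kzero) by apply: funext => j; exact: a0.
  by rewrite hadd0.
- by move=> _ ->; exact: kopp0.
- by move=> g i gi; exact: kmul_zero gi.
Qed.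

(** If [x - q] meets [I] and [q] is in [I], then [x] is in [I],
by reversibility. *)
Lemma hyperideal_cancel (I : set G) (x q z : G) :
  is_hyperideal I -> I q -> I z -> hadd (pad kzero [:: x; kopp q]) z -> I x.
Proof.
move=> hI Iq Iz /(hyp_rev (hadd_canonical G) (Ordinal (ltnW hm))).
have I0 := hyperideal0 hI.
apply: (hyperideal_add hI) => j; apply: pad_in => // -[//|i] /=.
rewrite ltnS size_map => hi; rewrite (nth_map (Ordinal hm)) //.
have := mem_nth (Ordinal hm) hi; rewrite mem_filter => /andP[i0 _].
apply: (hyperideal_opp hI); move: i0; set l := nth _ _ _.
case: l => [[|[|l]] hl] l0 //; rewrite /pad /=.
  exact: (hyperideal_opp hI).
by rewrite nth_nil.
Qed.

End Hyperideals.

(** * Homomorphisms preserving zero *)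

Section Homomorphisms.
Variables (m n : nat) (hm : (1 < m)%N) (hn : (1 < n)%N).
Variables (G1 G2 : krasner_hyperring m n) (f : G1 -> G2).
Hypothesis fhom : homomorphism f.

Lemma hom_kiter (l : nat) (a : nat -> G1) : f (kiter l a) = kiter l (f \o a).
Proof.
elim: l => [|l IH] //=; rewrite (hom_kmul fhom); congr kmul.
by apply: funext => j /=; case: ifP.
Qed.

Lemma hom_kprod (l : nat) (a : 'I_(l * n.-1).+1 -> G1) :
  f (kprod a) = kprod (f \o a).
Proof. exact: hom_kiter. Qed.

Hypothesis f0 : f kzero = kzero.

Lemma hom_pad (s : seq G1) :
  f \o pad kzero s = pad kzero (map f s) :> ('I_m -> G2).
Proof.
apply: funext => j; rewrite /pad /=; case: (ltnP j (size s)) => h.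
  by rewrite (nth_map kzero).
by rewrite !nth_default ?size_map.
Qed.

Lemma hom_kopp (x : G1) : f (kopp x) = kopp (f x).
Proof.
apply: (hyp_opp_uniq (hadd_canonical G2)).
rewrite -(hom_pad [:: x; kopp x]) -(hom_hadd fhom) -f0.
by exists kzero => //; exact: hyp_opp (hadd_canonical G1) x.
Qed.

(** Hyperideals containing the kernel are saturated. *)
Lemma preimage_image_hyperideal (I : set G1) :
  is_hyperideal I -> Ker f `<=` I -> f @^-1` (f @` I) = I.
Proof.
move=> hI kI; apply/seteqP; split; last exact: preimage_image.
move=> x [q Iq fqx].
have : hadd (f \o pad kzero [:: x; kopp q]) kzero.
  rewrite hom_pad /= hom_kopp fqx; exact: hyp_opp (hadd_canonical G2) _.
rewrite -(hom_hadd fhom) => -[z hz fz].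
exact: (hyperideal_cancel hm hn hI Iq (kI _ fz) hz).
Qed.

Lemma is_hyperideal_image (I : set G1) :
  (forall y, exists x, f x = y) -> is_hyperideal I -> Ker f `<=` I ->
  is_hyperideal (f @` I).
Proof.
move=> fsurj hI kI; split.
- by have [x Ix] := hyperideal_nonempty hI; exists (f x), x.
- move=> a aI.
  have /choice[q hq] : forall j, exists x, I x /\ f x = a j.
    by move=> j; have [x] := aI j; exists x.
  have -> : a = f \o q by apply: funext => j; have [_ /= ->] := hq j.
  rewrite -(hom_hadd fhom); apply: image_subset.
  by apply: (hyperideal_add hI) => j; have [] := hq j.
- by move=> _ [x Ix <-]; exists (kopp x); rewrite ?hom_kopp //;
    exact: hyperideal_opp hI _ Ix.
- move=> g i gi; have /choice[q hq] : forall j, exists x, f x = g j.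
    by move=> j; exact: fsurj.
  have -> : g = f \o q by apply: funext => j; rewrite /= hq.
  rewrite -(hom_kmul fhom); exists (kmul q) => //.
  apply: (hyperideal_mul hI (i := i)).
  by rewrite -(preimage_image_hyperideal hI kI) /preimage /= hq.
Qed.

End Homomorphisms.

(** A [delta delta']-homomorphism maps [0] to [0]. *)
Lemma hom_kzero (m n : nat) (hn : (1 < n)%N) (G1 G2 : krasner_hyperring m n)
    (delta : hyperideal G1 -> hyperideal G1)
    (delta' : hyperideal G2 -> hyperideal G2) (f : G1 -> G2) :
  expansion_homomorphism delta delta' f -> f kzero = kzero.
Proof.
move=> hf.
have [P PE _] := expansion_hom_preimage hf (Hyperideal (is_hyperideal_zero G2)).
suff : (f @^-1` [set kzero]) kzero by [].
by have := hyperideal0 hn (hyperidealP P); rewrite PE.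
Qed.

(** * Absorption *)

Section Absorption.
Variables (m n : nat) (hm : (1 < m)%N) (hn : (1 < n)%N).

(** Some [(t - 1)(n - 1) + 1] of the [a_i], with distinct indices, have their
product in [J]. *)
Definition has_subproduct (G : krasner_hyperring m n) (t : nat)
    (a : 'I_(t * n.-1).+1 -> G) (J : set G) : Prop :=
  exists2 s : 'I_(t.-1 * n.-1).+1 -> 'I_(t * n.-1).+1,
    injective s & J (kprod (a \o s)).

Lemma sub_has_subproduct (G : krasner_hyperring m n) (t : nat)
    (a : 'I_(t * n.-1).+1 -> G) (J K : set G) :
  J `<=` K -> has_subproduct a J -> has_subproduct a K.
Proof. by move=> JK [s si Js]; exists s => //; exact: JK. Qed.

Variables (G1 G2 : krasner_hyperring m n).
Variables (delta : hyperideal G1 -> hyperideal G1).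
Variables (delta' : hyperideal G2 -> hyperideal G2).
Variables (f : G1 -> G2) (t : nat).
Hypothesis hdelta : hyperideal_expansion delta.
Hypothesis hf : expansion_homomorphism delta delta' f.

Lemma has_subproduct_preimage (a : 'I_(t * n.-1).+1 -> G1) (J : set G2) :
  has_subproduct a (f @^-1` J) <-> has_subproduct (f \o a) J.
Proof.
by split=> -[s si]; rewrite /preimage /= ?(hom_kprod hf) => Js; exists s;
  rewrite /preimage /= ?(hom_kprod hf).
Qed.

Lemma absorbing_semiprimary_preimage (Q2 : set G2) :
  f @^-1` Q2 <> setT -> absorbing_semiprimary t delta' Q2 ->
  absorbing_semiprimary t delta (f @^-1` Q2).
Proof.
move=> /[swap] -[I [<- _ Iabs]] IT.
have [P PE dPE] := expansion_hom_preimage hf I.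
exists P; split=> // a; rewrite dPE /preimage /= (hom_kprod hf) => /Iabs.
by move=> ?; apply/has_subproduct_preimage.
Qed.

Lemma weakly_absorbing_semiprimary_preimage (Q2 : set G2) :
  f @^-1` Q2 <> setT -> weakly_absorbing_semiprimary t delta' Q2 ->
  weakly_absorbing_semiprimary t delta (Ker f) ->
  weakly_absorbing_semiprimary t delta (f @^-1` Q2).
Proof.
move=> /[swap] -[I [<- _ Iabs]] IT [K [KE _ Kabs]].
have [P PE dPE] := expansion_hom_preimage hf I.
exists P; split=> // a a0 aI.
have [fa0|fa0] := pselect (f (kprod a) = kzero).
  apply: (sub_has_subproduct _ (Kabs a a0 fa0)).
  apply: (expansion_mono hdelta); rewrite KE PE => x /= ->.
  exact (hyperideal0 hn (hyperidealP I)).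
rewrite dPE; apply/has_subproduct_preimage/Iabs; rewrite -(hom_kprod hf) //.
Qed.

Hypothesis fsurj : forall y, exists x, f x = y.

(** The absorption condition is only required of the products satisfying [C1],
resp. [C2]; these are always true in the plain case and say that the product is
nonzero in the weak case. *)
Lemma absorption_image (C1 : set G1) (C2 : set G2) (I Q1 : hyperideal G1) :
  Q1 <> setT :> set G1 -> Ker f `<=` Q1 -> I = Q1 :> set G1 ->
  f @^-1` C2 `<=` C1 ->
  (forall a : 'I_(t * n.-1).+1 -> G1, C1 (kprod a) ->
     (Q1 : set G1) (kprod a) -> has_subproduct a (delta I)) ->
  exists I2 : hyperideal G2,
    [/\ I2 = f @` Q1 :> set G2, f @` Q1 <> setT &
      forall b : 'I_(t * n.-1).+1 -> G2, C2 (kprod b) ->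
        (f @` Q1) (kprod b) -> has_subproduct b (delta' I2)].
Proof.
move=> Q1T kQ1 IE C12 Iabs.
have f0 := hom_kzero hn hf.
have satQ := preimage_image_hyperideal hm hn hf f0 (hyperidealP Q1) kQ1.
pose I2 := Hyperideal
  (is_hyperideal_image hm hn hf f0 fsurj (hyperidealP Q1) kQ1).
have [P PE dPE] := expansion_hom_preimage hf I2.
exists I2; split=> // [fQ1T|b Cb Qb].
  by apply: Q1T; rewrite -satQ fQ1T preimage_setT.
have /choice[a fa] : forall j, exists x, f x = b j by move=> j; exact: fsurj.
have bE : b = f \o a by apply: funext => j; rewrite /= fa.
rewrite bE -(hom_kprod hf) in Cb Qb.
rewrite bE; apply/has_subproduct_preimage; rewrite -dPE.
apply: (@sub_has_subproduct _ _ _ (delta I)).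
  by apply: (expansion_mono hdelta); rewrite IE PE satQ.
by apply: Iabs; [exact: C12 | rewrite -satQ].
Qed.

Lemma absorbing_semiprimary_image (Q1 : hyperideal G1) :
  Q1 <> setT :> set G1 -> Ker f `<=` Q1 ->
  absorbing_semiprimary t delta Q1 ->
  absorbing_semiprimary t delta' (f @` Q1).
Proof.
move=> Q1T kQ1 [I [IE _ Iabs]].
have [||I2 [I2E fQ1T I2abs]] :=
  @absorption_image setT setT I Q1 Q1T kQ1 IE => //.
  by move=> a _; exact: Iabs.
by exists I2; split=> // b; exact: I2abs.
Qed.

Lemma weakly_absorbing_semiprimary_image (Q1 : hyperideal G1) :
  Q1 <> setT :> set G1 -> Ker f `<=` Q1 ->
  weakly_absorbing_semiprimary t delta Q1 ->
  weakly_absorbing_semiprimary t delta' (f @` Q1).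
Proof.
move=> Q1T kQ1 [I [IE _ Iabs]].
apply: (@absorption_image [set~ kzero] [set~ kzero] I Q1 Q1T kQ1 IE) => //.
by move=> x /= fx0 x0; apply: fx0; rewrite x0 (hom_kzero hn hf).
Qed.

End Absorption.

(* The premises [f @^-1` Q2 <> setT] are needed: f is not assumed unital, so the
   preimage of a proper hyperideal may be everything (e.g. for f = 0), whereas
   absorbing hyperideals are proper by definition. *)
Theorem theorem2p34 (m n : nat) (hm : (1 < m)%N) (hn : (1 < n)%N)
    (G1 G2 : krasner_hyperring m n)
    (hcomm1 : kcommutative G1) (hcomm2 : kcommutative G2)
    (one1 : G1) (one2 : G2)
    (hone1 : scalar_identity one1) (hone2 : scalar_identity one2)
    (delta : hyperideal G1 -> hyperideal G1)
    (delta' : hyperideal G2 -> hyperideal G2)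
    (hdelta : hyperideal_expansion delta)
    (hdelta' : hyperideal_expansion delta')
    (t : nat) (ht : (0 < t)%N)
    (f : G1 -> G2) (hf : expansion_homomorphism delta delta' f) :
  (forall Q2 : set G2, f @^-1` Q2 <> setT ->
     absorbing_semiprimary t delta' Q2 ->
     absorbing_semiprimary t delta (f @^-1` Q2)) /\
  (forall Q2 : set G2, f @^-1` Q2 <> setT ->
     weakly_absorbing_semiprimary t delta' Q2 ->
     weakly_absorbing_semiprimary t delta (Ker f) ->
     weakly_absorbing_semiprimary t delta (f @^-1` Q2)) /\
  (epimorphism f ->
   forall Q1 : hyperideal G1, Q1 <> setT :> set G1 -> Ker f `<=` Q1 ->
     (absorbing_semiprimary t delta Q1 ->
      absorbing_semiprimary t delta' (f @` Q1)) /\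
     (weakly_absorbing_semiprimary t delta Q1 ->
      weakly_absorbing_semiprimary t delta' (f @` Q1))).
Proof.
split; first exact: (absorbing_semiprimary_preimage hf).
split; first exact: (weakly_absorbing_semiprimary_preimage hn hdelta hf).
move=> [_ fsurj] Q1 Q1T kQ1; split.
  exact: (absorbing_semiprimary_image hm hn hdelta hf fsurj).
exact: (weakly_absorbing_semiprimary_image hm hn hdelta hf fsurj).
Qed.
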